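(* Let $f,\hat f:\mathcal{V}\to\mathcal{Z}$ be two distinct envelopes of a discrete R-congruence (a discrete Ribaucour pair) related by a facewise constant Lie inversion $\sigma^{(3)}$. If $d=(D^{(1)},D^{(2)}):\mathcal{F}\to G_{(2,1)}(\mathbb{R}^{4,2})\times G_{(2,1)}(\mathbb{R}^{4,2})$ is a cyclidic net of $f$, then $$\hat d:\mathcal{F}\to G_{(2,1)}(\mathbb{R}^{4,2})\times G_{(2,1)}(\mathbb{R}^{4,2}),\qquad \hat d=\big(\sigma^{(3)}(D^{(1)}),\ \sigma^{(3)}(D^{(2)})\big)$$ (where on each face the Lie inversion belonging to that face is applied) is a cyclidic net of $\hat f$.
   Context: $\mathbb{R}^{4,2}$ is $\mathbb{R}^6$ with the inner product $\langle x,y\rangle=-x_1y_1+x_2y_2+x_3y_3+x_4y_4+x_5y_5-x_6y_6$; $\mathcal{L}$ is its light cone and $\mathbb{P}(\mathcal{L})$ its projectivization. Elements of $\mathbb{P}(\mathcal{L})$ are called (oriented) spheres; a Fraktur letter denotes homogeneous coordinates. Two spheres $r,s$ are in oriented contact iff $\langle\mathfrak{r},\mathfrak{s}\rangle=0$. A contact element is a projective line contained in $\mathbb{P}(\mathcal{L})$; $\mathcal{Z}$ is the set of contact elements. For $a\in\mathbb{P}(\mathbb{R}^{4,2})$ with $\langle\mathfrak{a},\mathfrak{a}\rangle\neq0$ the Lie inversion is $\sigma_{\mathfrak{a}}(\mathfrak{x})=\mathfrak{x}-\frac{2\langle\mathfrak{x},\mathfrak{a}\rangle}{\langle\mathfrak{a},\mathfrak{a}\rangle}\mathfrak{a}$.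 A linear system is a set $\mathbb{P}(\mathrm{span}\{\mathfrak{s}_1,\mathfrak{s}_2,\mathfrak{s}_3\})\cap\mathbb{P}(\mathcal{L})$ with $s_1,s_2,s_3$ spheres pairwise not in oriented contact. $\mathcal{G}=(\mathcal{V},\mathcal{E},\mathcal{F})$ is a connected quadrilateral cell complex of degree 4 with edges split by coordinate direction, $\mathcal{E}=\mathcal{E}^{(1)}\sqcup\mathcal{E}^{(2)}$; a face is written $(ijkl)$ (cyclic order), with $(ij),(kl)\in\mathcal{E}^{(1)}$ and $(jk),(il)\in\mathcal{E}^{(2)}$. A discrete R-congruence is a map $r:\mathcal{V}\to\mathbb{P}(\mathcal{L})$ such that for every face the four spheres are pairwise not in oriented contact and lie in a unique linear system. A discrete Legendre map is a map $f:\mathcal{V}\to\mathcal{Z}$ such that adjacent contact elements share a common sphere, the curvature sphere $s_{ij}:=f_i\cap f_j$; it is an envelope of $r$ if $r_i\in f_i$ for all $i$. Two envelopes $f,\hat f$ are related by a facewise constant Lie inversion $\sigma^{(3)}$ if there is a map $n^{(3)}:\mathcal{F}\to\mathbb{P}(\mathbb{R}^{4,2})\setminus\mathbb{P}(\mathcal{L})$ such that for every face the Lie inversion $\sigma^{(3)}=\sigma_{\mathfrak{n}^{(3)}}$ of this face maps the contact elements of $f$ at the four vertices of the face to the corresponding contact elements of $\hat f$ (equivalently, it interchanges corresponding curvature spheres $s\leftrightarrow\hat s$ of $f$ and $\hat f$ on the four edges of the face). $G_{(2,1)}(\mathbb{R}^{4,2})$ is the set of $3$-dimensional linear subspaces of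 signature $(2,1)$. A Dupin cyclide is an orthogonal splitting $\mathbb{R}^{4,2}=D^{(1)}\oplus_\perp D^{(2)}$ into two such subspaces; its curvature spheres are the spheres in $D^{(1)}$ and in $D^{(2)}$, its contact elements are $\mathrm{span}\{t_1,t_2\}$ with spheres $t_1\in D^{(1)}$, $t_2\in D^{(2)}$, and the contact elements along a curvature line are those containing one fixed curvature sphere. A face-cyclide of a discrete Legendre map at $(ijkl)$ is a Dupin cyclide with $s_{ij},s_{kl}\in D^{(1)}$ and $s_{il},s_{jk}\in D^{(2)}$. A cyclidic net of $f$ is a map $d$ assigning to every face a face-cyclide of $f$ such that the face-cyclides of any two faces adjacent along an edge $(ij)$ have the same contact elements along the curvature line passing through $f_i$ and $f_j$ (that is, the same contact elements containing $s_{ij}$). *)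

(* Defs.v *)
From HB Require Import structures.
From Stdlib Require Import Relation_Operators.
From mathcomp Require Import all_boot all_order all_algebra ring.
From mathcomp Require Import classical_sets reals.
Set Implicit Arguments.
Unset Strict Implicit.
Unset Printing Implicit Defensive.
Import Order.TTheory GRing.Theory Num.Theory.
Local Open Scope ring_scope.

(* R^{4,2} is the space of row vectors 'rV[R]_6, with coordinates numbered
   0, ..., 5. Points, lines, ... of its projective space are linear subspaces
   of dimension 1, 2, ..., incidence is inclusion, and P(U) for a subspace U
   is represented by U itself. *)

Section LieGeometry.
Variable R : realType.
Local Notation V := 'rV[R]_6.
Implicit Types (x y a : V) (p r s t c U W D : {vspace V}).

Definition lip x y : R :=
  - (x 0 0 * y 0 0) + x 0 1 * y 0 1 + x 0 2 * y 0 2 + x 0 3 * y 0 3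
  + x 0 4 * y 0 4 - x 0 5 * y 0 5.

Definition in_light_cone U : Prop := forall x, x \in U -> lip x x = 0.

Definition point p : Prop := \dim p = 1%N.

Definition sphere p : Prop := point p /\ in_light_cone p.

Definition contact_element c : Prop := \dim c = 2%N /\ in_light_cone c.

Definition orthogonal_spaces U W : Prop :=
  forall x y, x \in U -> y \in W -> lip x y = 0.

Definition oriented_contact r s : Prop := orthogonal_spaces r s.

Definition reflection a x : V := x - (2 * lip x a / lip a a) *: a.

Fact reflection_is_linear a : linear (reflection a).
Proof.
move=> k x y; rewrite /reflection.
have -> : lip (k *: x + y) a = k * lip x a + lip y a.
  by rewrite /lip !mxE; ring.
apply/rowP=> i; rewrite !mxE; ring.
Qed.

HB.instance Definition _ a :=
  GRing.isLinear.Build R V V *:%R (reflection a) (reflection_is_linear a).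

(* vpick n is a nonzero vector of n, i.e. homogeneous coordinates of the
   point n; the reflection does not depend on the choice of coordinates. *)
Definition lie_inversion (n : {vspace V}) : 'End(V) :=
  linfun (reflection (vpick n)).

Definition linear_system (S : set {vspace V}) : Prop :=
  exists s1 s2 s3,
    [/\ [/\ sphere s1, sphere s2 & sphere s3],
        [/\ ~ oriented_contact s1 s2, ~ oriented_contact s1 s3
          & ~ oriented_contact s2 s3]
      & S = [set s | sphere s /\ (s <= s1 + s2 + s3)%VS]%classic].

(* p positive and q negative directions; the form is nondegenerate on D. *)
Definition has_signature (p q : nat) D : Prop :=
  exists X : (p + q).-tuple V,
    [/\ basis_of D X,
        forall i j : 'I_(p + q), i != j -> lip (tnth X i) (tnth X j) = 0
      & forall i : 'I_(p + q),
          if (i < p)%N then 0 < lip (tnth X i) (tnth X i)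
          else lip (tnth X i) (tnth X i) < 0].

Definition G21 D : Prop := \dim D = 3%N /\ has_signature 2 1 D.

Definition dupin_cyclide (D : {vspace V} * {vspace V}) : Prop :=
  [/\ G21 D.1, G21 D.2, orthogonal_spaces D.1 D.2,
      (D.1 + D.2 = fullv)%VS & (D.1 :&: D.2 = 0)%VS].

Definition cyclide_contact_element (D : {vspace V} * {vspace V}) c : Prop :=
  exists t1 t2,
    [/\ sphere t1 /\ (t1 <= D.1)%VS, sphere t2 /\ (t2 <= D.2)%VS
      & c = (t1 + t2)%VS].

(* The contact elements along the curvature line of the curvature sphere s. *)
Definition curvature_line (D : {vspace V} * {vspace V}) s : set {vspace V} :=
  [set c | cyclide_contact_element D c /\ (s <= c)%VS]%classic.

End LieGeometry.

(* The face phi = (ijkl) has the vertices i, j, k, l = corner phi q for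
   q = 0, 1, 2, 3, and ordS is the cyclic successor on 'I_4. An edge is given
   by its endpoints; edge false is E^(1) and edge true is E^(2). *)
Record quad_data := QuadData {
  vertex : Type;
  face : Type;
  edge : bool -> vertex -> vertex -> Prop;
  corner : face -> 'I_4 -> vertex
}.

Section CellComplex.
Variable G : quad_data.
Implicit Types (i j v w : vertex G) (phi psi : face G).

Definition adjacent i j : Prop := exists m, edge m i j.

Definition edge_of_face phi i j : Prop :=
  exists q, (i = corner phi q /\ j = corner phi (ordS q)) \/
            (j = corner phi q /\ i = corner phi (ordS q)).

Definition interior_vertex v : Prop :=
  forall w, adjacent v w ->
    exists phi psi, [/\ phi <> psi, edge_of_face phi v w & edge_of_face psi v w].

(* Boundaries are allowed: only interior vertices must have degree 4. *)
Record quad_complex_deg4 : Prop := QuadComplexDeg4 {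
  edge_sym : forall m i j, edge m i j -> edge m j i;
  edge_irrefl : forall m i, ~ edge m i i;
  edge_disjoint : forall i j, ~ (edge false i j /\ edge true i j);
  corner_inj : forall phi, injective (corner phi);
  (* (ij) and (kl) are in E^(1), (jk) and (li) are in E^(2) *)
  face_edges : forall phi (q : 'I_4), edge (odd q) (corner phi q) (corner phi (ordS q));
  edge_in_face : forall i j, adjacent i j -> exists phi, edge_of_face phi i j;
  connected_complex : forall i j, clos_refl_trans _ adjacent i j;
  degree4 : forall v, interior_vertex v ->
    exists nb : 'I_4 -> vertex G,
      injective nb /\ forall w, adjacent v w <-> exists q, w = nb q
}.

End CellComplex.

Section Nets.
Variables (R : realType) (G : quad_data).
Local Notation V := 'rV[R]_6.
Implicit Types (r f fhat : vertex G -> {vspace V}) (n : face G -> {vspace V}).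

Definition R_congruence r : Prop :=
  (forall i, sphere (r i)) /\
  forall phi,
    (forall q q' : 'I_4, q != q' ->
       ~ oriented_contact (r (corner phi q)) (r (corner phi q'))) /\
    exists! S : set {vspace V},
      linear_system S /\ forall q, S (r (corner phi q)).

Definition curvature_sphere f (i j : vertex G) : {vspace V} :=
  (f i :&: f j)%VS.

Definition legendre_map f : Prop :=
  (forall i, contact_element (f i)) /\
  (forall i j, adjacent i j -> sphere (curvature_sphere f i j)).

Definition envelope r f : Prop :=
  legendre_map f /\ forall i, (r i <= f i)%VS.

Definition facewise_lie_inversion n f fhat : Prop :=
  (forall phi, point (n phi) /\ ~ in_light_cone (n phi)) /\
  (forall phi q,
     (lie_inversion (n phi) @: f (corner phi q))%VS = fhat (corner phi q)).

(* With q = 0, 2 for s_ij, s_kl in D.1 and q = 1, 3 for s_jk, s_li in D.2. *)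
Definition face_cyclide f (phi : face G) (D : {vspace V} * {vspace V}) : Prop :=
  dupin_cyclide D /\
  forall q : 'I_4,
    (curvature_sphere f (corner phi q) (corner phi (ordS q))
       <= if odd q then D.2 else D.1)%VS.

Definition cyclidic_net f (d : face G -> {vspace V} * {vspace V}) : Prop :=
  (forall phi, face_cyclide f phi (d phi)) /\
  (forall phi psi i j, edge_of_face phi i j -> edge_of_face psi i j ->
     curvature_line (d phi) (curvature_sphere f i j) =
     curvature_line (d psi) (curvature_sphere f i j)).

End Nets.

(* Main.v *)
From mathcomp Require Import all_boot all_order all_algebra ring.
From mathcomp Require Import boolp classical_sets reals.
Require Import Defs.
Set Implicit Arguments.
Unset Strict Implicit.
Unset Printing Implicit Defensive.
Import Order.TTheory GRing.Theory Num.Theory.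
Local Open Scope ring_scope.

(** A Lie inversion is an injective isometry, so it carries the face-cyclide of
    [f] on each single face to a face-cyclide of [fhat]. What has to be proved
    is the compatibility along an edge (ij) shared by two faces, on which two
    different Lie inversions act.

    Let s and shat be the curvature spheres of [f] and [fhat] on that edge, and
    suppose that they differ. A Lie inversion exchanging them has its pole on
    the line spanned by s and shat; as the pole is not isotropic, s and shat are
    not in oriented contact, and the inversion fixes every vector orthogonal to
    both. A contact element c through s is spanned by s and the sphere of c in
    oriented contact with shat, so its image is spanned by shat and that same
    sphere, whichever of the inversions exchanging s and shat is used
    ([lie_inversion_contact_element]). The two inversions therefore agree on the
    contact elements along the curvature line of s, and compatibility for [f]
    becomes compatibility for [fhat].

    It remains to exclude s = shat ([curvature_sphere_neq]). Neighbouring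
    spheres of the R-congruence are not in oriented contact, so the contact
    element at a vertex is spanned by the sphere of the congruence and the
    curvature sphere of any edge at that vertex ([contact_element_span]). Hence
    s = shat forces [f i = fhat i]. An inversion preserving a totally isotropic
    space fixes it pointwise, so at a neighbour l the curvature sphere of [f] is
    fixed and lies in [fhat l] together with [r l]; that is, [f l = fhat l]. As
    the complex is connected, the two envelopes would coincide. *)

(** * The Lie inner product and isometries *)

Section Isometries.
Variable R : realType.
Local Notation V := 'rV[R]_6.
Implicit Types (x y z a u : V) (p s c U W : {vspace V}).

Lemma lipC x y : lip x y = lip y x.
Proof. by rewrite /lip; ring. Qed.

Lemma lipDl x y z : lip (x + y) z = lip x z + lip y z.
Proof. by rewrite /lip !mxE; ring. Qed.

Lemma lipZl k x y : lip (k *: x) y = k * lip x y.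
Proof. by rewrite /lip !mxE; ring. Qed.

Lemma lipBl x y z : lip (x - y) z = lip x z - lip y z.
Proof. by rewrite /lip !mxE; ring. Qed.

Lemma lipBr x y z : lip x (y - z) = lip x y - lip x z.
Proof. by rewrite lipC lipBl !(lipC x). Qed.

Lemma lipZr k x y : lip x (k *: y) = k * lip x y.
Proof. by rewrite lipC lipZl lipC. Qed.

Lemma lipDr x y z : lip x (y + z) = lip x y + lip x z.
Proof. by rewrite lipC lipDl !(lipC x). Qed.

Lemma in_light_cone_orthogonal U : in_light_cone U -> orthogonal_spaces U U.
Proof.
move=> hU x y xU yU.
have := hU _ (memvD xU yU).
rewrite lipDl !lipDr (hU _ xU) (hU _ yU) (lipC y x) add0r addr0 -mulr2n.
by move/eqP; rewrite mulrn_eq0 /= => /eqP.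
Qed.

Lemma pointE p x : point p -> x \in p -> x != 0 -> p = <[x]>%VS.
Proof.
move=> hp xp x0; apply/esym/eqP.
by rewrite eqEdim -memvE xp dim_vline x0 hp.
Qed.

Lemma cyclide_contact_element_light_cone (D : {vspace V} * {vspace V}) c :
  orthogonal_spaces D.1 D.2 -> cyclide_contact_element D c -> in_light_cone c.
Proof.
move=> oD [t1] [t2] [[[_ h1] s1] [[_ h2] s2] ->] _ /memv_addP[x xt1 [y yt2 ->]].
rewrite lipDl !lipDr (h1 _ xt1) (h2 _ yt2) (lipC y x).
by rewrite (oD _ _ (subvP s1 _ xt1) (subvP s2 _ yt2)) !addr0.
Qed.

Section Image.
Variable g : 'End(V).
Hypothesis g_inj : lker g == 0%VS.
Hypothesis g_lip : forall x y, lip (g x) (g y) = lip x y.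

Lemma capv_lker0 U : (U :&: lker g)%VS = 0%VS.
Proof. by rewrite (eqP g_inj) capv0. Qed.

Lemma dim_img U : \dim (g @: U) = \dim U.
Proof. by rewrite limg_dim_eq // capv_lker0. Qed.

Lemma img_cap U W : (g @: (U :&: W) = g @: U :&: g @: W)%VS.
Proof.
apply/eqP; rewrite eqEsubv limg_cap; apply/subvP => z.
rewrite memv_cap => /andP[/memv_imgP[x xU ->] /memv_imgP[y yW]].
move=> /(lker0P g_inj) exy; apply/memv_img.
by rewrite memv_cap xU exy yW.
Qed.

Lemma sphere_img s : sphere s -> sphere (g @: s)%VS.
Proof.
move=> [ps ls]; split; first by rewrite /point dim_img.
by move=> _ /memv_imgP[x xs ->]; rewrite g_lip ls.
Qed.

Lemma orthogonal_img U W :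
  orthogonal_spaces U W -> orthogonal_spaces (g @: U)%VS (g @: W)%VS.
Proof.
move=> h _ _ /memv_imgP[x xU ->] /memv_imgP[y yW ->].
by rewrite g_lip h.
Qed.

Lemma has_signature_img (p q : nat) U :
  has_signature p q U -> has_signature p q (g @: U)%VS.
Proof.
move=> [X [bX oX sX]]; exists [tuple of map g X]; split.
- exact: limg_basis_of (capv_lker0 U) bX.
- by move=> i j ij; rewrite !tnth_map g_lip oX.
- by move=> i; rewrite tnth_map !g_lip; apply: sX.
Qed.

Lemma dupin_cyclide_img (D : {vspace V} * {vspace V}) :
  dupin_cyclide D -> dupin_cyclide ((g @: D.1)%VS, (g @: D.2)%VS).
Proof.
move=> [[d1 s1] [d2 s2] o sumD capD]; split=> /=.
- by split; [rewrite dim_img|exact: has_signature_img].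
- by split; [rewrite dim_img|exact: has_signature_img].
- exact: orthogonal_img.
- rewrite -limgD sumD; apply/eqP.
  by rewrite eqEdim subvf dim_img leqnn.
- by rewrite -img_cap capD limg0.
Qed.

Lemma curvature_line_img (D : {vspace V} * {vspace V}) s c :
  curvature_line D s c ->
  curvature_line ((g @: D.1)%VS, (g @: D.2)%VS) (g @: s)%VS (g @: c)%VS.
Proof.
move=> [[t1] [t2] [[h1 l1] [h2 l2] ->]] sc; split; last exact: limgS.
exists (g @: t1)%VS, (g @: t2)%VS; split=> /=; last exact: limgD.
- by split; [exact: sphere_img|exact: limgS].
- by split; [exact: sphere_img|exact: limgS].
Qed.

End Image.

(** * Lie inversions *)

Lemma lip_reflection a x y :
  lip a a != 0 -> lip (reflection a x) (reflection a y) = lip x y.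
Proof.
move=> a0; rewrite /reflection !lipBl !lipBr !lipZl !lipZr (lipC a y).
by field.
Qed.

Lemma reflectionK a : lip a a != 0 -> involutive (reflection a).
Proof.
move=> a0 x; rewrite /reflection lipBl lipZl -addrA -opprD -scalerDl.
have -> : 2 * lip x a / lip a a +
  2 * (lip x a - 2 * lip x a / lip a a * lip a a) / lip a a = 0 by field.
by rewrite scale0r subr0.
Qed.

Section LieInversion.
Variable n : {vspace V}.
Hypothesis n_point : point n.
Hypothesis n_cone : ~ in_light_cone n.

Local Notation sigma := (lie_inversion n).

Lemma lie_inversionE x : sigma x = reflection (vpick n) x.
Proof. by rewrite lfunE. Qed.

Lemma lip_pole_neq0 : lip (vpick n) (vpick n) != 0.
Proof.
apply/eqP=> h; apply: n_cone => x.
have n0 : vpick n != 0 by rewrite vpick0 -dimv_eq0 n_point.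
rewrite (pointE n_point (memv_pick n) n0) => /vlineP[k ->].
by rewrite lipZl lipZr h !mulr0.
Qed.

Lemma lip_lie_inversion x y : lip (sigma x) (sigma y) = lip x y.
Proof. by rewrite !lie_inversionE lip_reflection // lip_pole_neq0. Qed.

Lemma lie_inversionK : involutive sigma.
Proof. by move=> x; rewrite !lie_inversionE reflectionK // lip_pole_neq0. Qed.

Lemma lie_inversion_ker : lker sigma == 0%VS.
Proof. by apply/lker0P; apply: inv_inj; apply: lie_inversionK. Qed.

Lemma lie_inversion_imgK U : (sigma @: (sigma @: U))%VS = U.
Proof.
apply/vspaceP => x; apply/idP/idP.
  by move=> /memv_imgP[y /memv_imgP[z zU ->] ->]; rewrite lie_inversionK.
by move=> xU; rewrite -(lie_inversionK x) !memv_img.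
Qed.

Lemma lie_inversion_displacement x : exists k, x - sigma x = k *: vpick n.
Proof.
by eexists; rewrite lie_inversionE /reflection subKr.
Qed.

(** The displacement of a vector of [U] lies in [U] and is a multiple of the
    pole, which is not isotropic. *)
Lemma lie_inversion_fix_light_cone U :
  in_light_cone U -> (sigma @: U <= U)%VS -> {in U, forall x, sigma x = x}.
Proof.
move=> hU sU x xU; have [k hk] := lie_inversion_displacement x.
have : x - sigma x \in U by rewrite rpredB // (subvP sU) // memv_img.
move=> /hU; rewrite hk lipZl lipZr => /eqP.
rewrite !mulf_eq0 (negPf lip_pole_neq0) orbF orbb => /eqP k0.
by move/eqP: hk; rewrite k0 scale0r subr_eq0 => /eqP.
Qed.

(** If [sigma] moves [u], then its pole is proportional to [u - sigma u]. *)
Lemma lie_inversion_fix_orthogonal u x :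
  sigma u != u -> lip x u = 0 -> lip x (sigma u) = 0 -> sigma x = x.
Proof.
move=> uu xu xsu; have [k hk] := lie_inversion_displacement u.
have k0 : k != 0.
  apply: contra uu => /eqP k0; move/eqP: hk.
  by rewrite k0 scale0r subr_eq0 eq_sym.
have : lip x (u - sigma u) = 0 by rewrite lipBr xu xsu subr0.
rewrite hk lipZr => /eqP; rewrite mulf_eq0 (negPf k0) /= => /eqP xn.
by rewrite lie_inversionE /reflection xn mulr0 mul0r scale0r subr0.
Qed.

(** Otherwise the pole would lie in the span of two orthogonal isotropic
    vectors, hence be isotropic. *)
Lemma lip_lie_inversion_neq0 u :
  lip u u = 0 -> sigma u != u -> lip u (sigma u) != 0.
Proof.
move=> u0; apply: contra => /eqP uu.
have [k hk] := lie_inversion_displacement u.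
have : lip (u - sigma u) (u - sigma u) = 0.
  by rewrite lipBl !lipBr lip_lie_inversion (lipC _ u) u0 uu !subr0.
rewrite hk lipZl lipZr => /eqP.
rewrite !mulf_eq0 (negPf lip_pole_neq0) orbF orbb => /eqP k0.
by move/eqP: hk; rewrite k0 scale0r subr_eq0 eq_sym.
Qed.

End LieInversion.

Lemma lie_inversion_contact_element_le n m s c :
  point n -> ~ in_light_cone n -> point m -> ~ in_light_cone m ->
  point s -> in_light_cone c -> (s <= c)%VS ->
  (lie_inversion n @: s)%VS = (lie_inversion m @: s)%VS ->
  (lie_inversion n @: s)%VS <> s ->
  (lie_inversion n @: c <= lie_inversion m @: c)%VS.
Proof.
move=> pn cn pm cm ps lc sc nms ns.
set sn := lie_inversion n; set sm := lie_inversion m.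
set u := vpick s; have u0 : u != 0 by rewrite vpick0 -dimv_eq0 ps.
have us : s = <[u]>%VS := pointE ps (memv_pick s) u0.
have uc : u \in c by rewrite (subvP sc) // memv_pick.
have moved (g : 'End(V)) : (g @: s)%VS <> s -> g u != u.
  by move=> gs; apply/eqP => gu; apply: gs; rewrite {1}us limg_line gu -us.
have nu := moved _ ns.
have mu : sm u != u by apply: moved; rewrite -nms.
have uw := lip_lie_inversion_neq0 pn cn (lc _ uc) nu.
have /vlineP[b mub] : sm u \in <[sn u]>%VS.
  by rewrite -limg_line -us nms memv_img // memv_pick.
apply/subvP => _ /memv_imgP[x xc ->].
(* z is the part of x orthogonal to the image of s, hence fixed by both *)
pose k := lip x (sn u) / lip u (sn u); pose z := x - k *: u.
have zc : z \in c by rewrite rpredB // rpredZ.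
have zu : lip z u = 0 := in_light_cone_orthogonal lc zc uc.
have zw : lip z (sn u) = 0 by rewrite /z lipBl lipZl /k divfK // subrr.
have nz : sn z = z := lie_inversion_fix_orthogonal nu zu zw.
have mz : sm z = z.
  by apply: lie_inversion_fix_orthogonal mu zu _; rewrite mub lipZr zw mulr0.
have -> : sn x = sm z + k *: sn u.
  by rewrite mz -[in RHS]nz /z -linearZ -linearD subrK.
rewrite rpredD ?rpredZ ?memv_img //.
apply: (subvP (limgS sm sc)); rewrite -nms; apply: memv_img; exact: memv_pick.
Qed.

(** The space [c] is spanned by [s] and the vectors of [c] orthogonal to the
    image of [s]. These are orthogonal to [s] as well, since [c] is isotropic, so
    both inversions fix them. That [s] is moved is essential: the inversions with
    a pole orthogonal to [s] all fix [s], but in general they move the contact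
    elements through [s] differently. *)
Lemma lie_inversion_contact_element n m s c :
  point n -> ~ in_light_cone n -> point m -> ~ in_light_cone m ->
  point s -> in_light_cone c -> (s <= c)%VS ->
  (lie_inversion n @: s)%VS = (lie_inversion m @: s)%VS ->
  (lie_inversion n @: s)%VS <> s ->
  (lie_inversion n @: c)%VS = (lie_inversion m @: c)%VS.
Proof.
move=> pn cn pm cm ps lc sc nms ns; apply/eqP; rewrite eqEsubv.
by rewrite !(@lie_inversion_contact_element_le _ _ s) // -nms.
Qed.

End Isometries.

(** * Envelopes of an R-congruence *)

Lemma ordS_neq (q : 'I_4) : ordS q != q.
Proof. by case: q => [[|[|[|[|//]]]] hq]. Qed.

Section Envelopes.
Variables (R : realType) (G : quad_data).
Hypothesis hG : quad_complex_deg4 G.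
Variables (r : vertex G -> {vspace 'rV[R]_6}).
Hypothesis hr : R_congruence r.
Implicit Types (f fhat : vertex G -> {vspace 'rV[R]_6}) (phi : face G).

Lemma edge_of_face_corners phi i j :
  edge_of_face phi i j ->
  (exists q, i = corner phi q) /\ (exists q, j = corner phi q).
Proof. by move=> [q [[-> ->]|[-> ->]]]; split; eexists. Qed.

Lemma edge_of_face_adjacent phi i j : edge_of_face phi i j -> adjacent i j.
Proof.
move=> [q [[-> ->]|[-> ->]]]; exists (odd q); first exact: face_edges.
by apply: edge_sym => //; apply: face_edges.
Qed.

Lemma adjacent_no_contact i j : adjacent i j -> ~ oriented_contact (r i) (r j).
Proof.
move=> /(edge_in_face hG)[phi [q hq]].
have [hphi _] := hr.2 phi.
by case: hq => -[-> ->]; apply: hphi; rewrite ?ordS_neq // eq_sym ordS_neq.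
Qed.

(** If [r j] were the curvature sphere of the edge, it would lie in [f i] like
    [r i], and the two would be in oriented contact. *)
Lemma contact_element_span f i j :
  envelope r f -> adjacent i j -> f j = (r j + curvature_sphere f i j)%VS.
Proof.
move=> [[fc fs] rf] ij; have [ps _] := fs _ _ ij.
have [pr _] := hr.1 j.
apply/esym/eqP; rewrite eqEdim subv_add rf capvSr /= (fc j).1.
have cap0 : (r j :&: curvature_sphere f i j = 0)%VS.
  apply/eqP; rewrite -dimv_eq0.
  have := dimvS (capvSl (r j) (curvature_sphere f i j)).
  rewrite leq_eqVlt => /orP[/eqP e|]; last by rewrite pr ltnS leqn0.
  have rj : (r j <= curvature_sphere f i j)%VS.
    by apply/capv_idPl/eqP; rewrite eqEdim capvSl e leqnn.
  case: (adjacent_no_contact ij) => x y xi yj.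
  apply: (in_light_cone_orthogonal (fc i).2); first exact: (subvP (rf i)).
  exact: (subvP (capvSl _ _) _ (subvP rj _ yj)).
by rewrite dimv_disjoint_sum // pr ps.
Qed.

Variables (f fhat : vertex G -> {vspace 'rV[R]_6}).
Variable n : face G -> {vspace 'rV[R]_6}.
Hypotheses (hf : envelope r f) (hfhat : envelope r fhat).
Hypothesis hn : facewise_lie_inversion n f fhat.

Lemma curvature_sphere_img phi i j :
  edge_of_face phi i j ->
  (lie_inversion (n phi) @: curvature_sphere f i j)%VS =
  curvature_sphere fhat i j.
Proof.
move=> /edge_of_face_corners[[q ->] [q' ->]].
have [pn cn] := hn.1 phi.
by rewrite /curvature_sphere (img_cap (lie_inversion_ker pn cn)) !hn.2.
Qed.

(** The inversion of a face at the edge fixes [f i] pointwise, in particular the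
    curvature sphere, which together with [r j] spans [f j]. *)
Lemma envelope_eq_adjacent i j : adjacent i j -> f i = fhat i -> f j = fhat j.
Proof.
move=> ij fi; have [phi ijphi] := edge_in_face hG ij.
have [pn cn] := hn.1 phi; have [[q iq] _] := edge_of_face_corners ijphi.
have sfi : (lie_inversion (n phi) @: f i <= f i)%VS.
  by rewrite [X in (_ <= X)%VS]fi iq hn.2 subvv.
have fix_fi := lie_inversion_fix_light_cone pn cn (hf.1.1 i).2 sfi.
apply/eqP; rewrite eqEdim (hf.1.1 j).1 (hfhat.1.1 j).1 leqnn andbT.
rewrite (contact_element_span hf ij) subv_add hfhat.2 /=.
apply/subvP => x xs; apply: (subvP (capvSr (fhat i) (fhat j))).
rewrite -[(_ :&: _)%VS](curvature_sphere_img ijphi).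
by rewrite -(fix_fi _ (subvP (capvSl _ _) _ xs)) memv_img.
Qed.

Lemma envelope_eq i j : f i = fhat i -> f j = fhat j.
Proof.
have c := connected_complex hG i j.
by elim: c => [k l /envelope_eq_adjacent|k|k l m _ IHkl _ IHlm fk]; auto.
Qed.

Lemma curvature_sphere_neq i j :
  f <> fhat -> adjacent i j ->
  curvature_sphere f i j <> curvature_sphere fhat i j.
Proof.
move=> ne ij es; apply: ne; apply/funext => k; apply: (@envelope_eq j).
by rewrite (contact_element_span hf ij) es -contact_element_span.
Qed.

End Envelopes.

(** * Transport of the cyclidic net *)

Theorem theorem5p10 (R : realType) (G : quad_data) (hG : quad_complex_deg4 G)
    (r f fhat : vertex G -> {vspace 'rV[R]_6})
    (n : face G -> {vspace 'rV[R]_6})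
    (d : face G -> {vspace 'rV[R]_6} * {vspace 'rV[R]_6})
    (hr : R_congruence r) (hf : envelope r f) (hfhat : envelope r fhat)
    (hne : f <> fhat)
    (hn : facewise_lie_inversion n f fhat)
    (hd : cyclidic_net f d) :
  cyclidic_net fhat
    (fun phi => ((lie_inversion (n phi) @: (d phi).1)%VS,
                 (lie_inversion (n phi) @: (d phi).2)%VS)).
Proof.
split=> [phi|].
  have [pn cn] := hn.1 phi; have [dup sph] := hd.1 phi; split.
    exact: dupin_cyclide_img (lie_inversion_ker pn cn)
      (lip_lie_inversion pn cn) _ dup.
  move=> q; rewrite -(curvature_sphere_img hn (phi := phi)); last by exists q; left.
  by have := limgS (lie_inversion (n phi)) (sph q); case: (odd q).
have incl phi psi i j c : edge_of_face phi i j -> edge_of_face psi i j ->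
  curvature_line ((lie_inversion (n phi) @: (d phi).1)%VS,
    (lie_inversion (n phi) @: (d phi).2)%VS) (curvature_sphere fhat i j) c ->
  curvature_line ((lie_inversion (n psi) @: (d psi).1)%VS,
    (lie_inversion (n psi) @: (d psi).2)%VS) (curvature_sphere fhat i j) c.
  move=> ijphi ijpsi hc.
  have [pn cn] := hn.1 phi; have [pm cm] := hn.1 psi.
  have ij := edge_of_face_adjacent hG ijphi.
  have [ps _] := hf.1.2 _ _ ij.
  set s := curvature_sphere f i j in ps *.
  have phis := curvature_sphere_img hn ijphi.
  have psis := curvature_sphere_img hn ijpsi.
  (* e is the contact element of f corresponding to c *)
  pose e := (lie_inversion (n phi) @: c)%VS.
  have he : curvature_line (d phi) s e.
    have := curvature_line_img (lie_inversion_ker pn cn)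
      (lip_lie_inversion pn cn) hc.
    by rewrite /= -{1}phis !lie_inversion_imgK //; case: (d phi).
  have [_ _ od _ _] := (hd.1 phi).1.
  have le := cyclide_contact_element_light_cone od he.1.
  have -> : c = (lie_inversion (n psi) @: e)%VS.
    rewrite -(lie_inversion_contact_element (n := n phi) (s := s)) ?he.2 //.
    - by rewrite lie_inversion_imgK.
    - by rewrite phis psis.
    - rewrite phis => /esym.
      exact: (curvature_sphere_neq hG hr hf hfhat hn hne ij).
  rewrite -psis; apply: curvature_line_img.
  - exact: lie_inversion_ker.
  - exact: lip_lie_inversion.
  - by rewrite -(hd.2 phi psi i j).
move=> phi psi i j ijphi ijpsi; apply/seteqP.
by split=> c; apply: incl.
Qed.
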